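(* Let $\mathcal{X}=(X_N,\rho^N_M)$ be a projective spectrum of regular inductive limits of normed spaces $X_N=\operatorname{ind}_n X_{N,n}$ with inclusions as linking maps and with projective limit $X$. Let $B_{N,n}$ denote the closed unit ball of $X_{N,n}$, and assume $$\text{(B1)}\qquad \forall N\;\exists M\;\forall m\;\exists n:\quad B_{M,m}\subseteq \bigcap_{k\in\mathbb{N}}\Big((B_{N,n}\cap X)+\tfrac1k B_{N,n}\Big).$$ Then $X$ is bornological if and only if every absolutely convex and bornivorous set $T\subseteq X$ satisfies $$\text{(B2)}\qquad \exists N\;\forall n\;\exists S>0:\quad B_{N,n}\cap X\subseteq ST.$$
   Context: Indices $N,M,n,m,k$ range over $\mathbb{N}=\{1,2,\dots\}$. For each $N$, $(X_{N,n})_{n}$ is an increasing sequence of normed spaces with continuous inclusions $X_{N,n}\subseteq X_{N,n+1}$, and $X_N=\operatorname{ind}_nX_{N,n}=\bigcup_n X_{N,n}$ carries the locally convex inductive limit topology. $X_{N+1}$ is a linear subspace of $X_N$ with continuous inclusion; the linking maps $\rho^N_M:X_M\to X_N$ ($N\le M$) are these inclusions. The projective limit is $X=\operatorname{proj}_N\operatorname{ind}_nX_{N,n}=\bigcap_N X_N$ with the initial topology with respect to the inclusions into the $X_N$. Regularity means that every bounded subset of $X_N$ is contained and bounded in some $X_{N,n}$; the standing normalization is that for each $N$ and each bounded set $B\subseteq X_N$ there is $n$ with $B\subseteq B_{N,n}$. A set $T\subseteq X$ is bornivorous if it absorbs every bounded subset of $X$. A locally convex space is bornological if every absolutely convex bornivorous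 set is a 0-neighborhood. *)

(* Defs.v *)
From HB Require Import structures.
From mathcomp Require Import all_boot all_order all_algebra complex.
From mathcomp Require Import all_classical all_reals all_analysis.

Set Implicit Arguments.
Unset Strict Implicit.
Unset Printing Implicit Defensive.

Import Order.TTheory GRing.Theory Num.Theory.
Import numFieldNormedType.Exports.

Local Open Scope classical_set_scope.
Local Open Scope ring_scope.

(* The scalar field is R or C. *)
Definition real_or_complex (K : numFieldType) : Prop :=
  exists R : realType, K = (R : numFieldType) \/ K = (R[i] : numFieldType).

Section LocallyConvexSpaces.
Variables (K : numFieldType) (E : tvsType K).

Definition absorbs (U B : set E) : Prop :=
  exists2 r : K, 0 < r &
    forall a : K, r <= `|a| -> B `<=` [set a *: x | x in U].

Definition tvs_bounded (B : set E) : Prop :=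
  forall U : set E, nbhs 0 U -> absorbs U B.

Definition balanced (T : set E) : Prop :=
  forall (a : K) (x : E), `|a| <= 1 -> T x -> T (a *: x).

Definition absolutely_convex (T : set E) : Prop :=
  convex_set T /\ balanced T.

Definition bornivorous (T : set E) : Prop :=
  forall B : set E, tvs_bounded B -> absorbs T B.

Definition bornological : Prop :=
  forall T : set E, absolutely_convex T -> bornivorous T -> nbhs 0 T.

End LocallyConvexSpaces.

(* All spaces are linear subspaces of one ambient vector space V, each given  *)
(* by its own (locally convex or normed) type and an injective linear map to  *)
(* V. The following says that the space F embedded by f is contained in the   *)
(* space G embedded by g, with continuous inclusion; the map j is unique and  *)
(* linear when g is injective.                                                *)
Definition continuous_inclusion (V : Type) (F G : topologicalType)
    (f : F -> V) (g : G -> V) : Prop :=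
  exists2 j : F -> G, (forall x, g (j x) = f x) & continuous j.

(* The topology of L is the finest locally convex topology on the union of    *)
(* the subspaces Y n making all inclusions of the Y n continuous: a competing *)
(* locally convex topology on that union is given by a locally convex space F *)
(* embedded with the same range as L.                                         *)
Definition is_inductive_limit (K : numFieldType) (V : lmodType K)
    (Y : nat -> normedModType K) (y : forall n, {linear Y n -> V})
    (L : tvsType K) (l : {linear L -> V}) : Prop :=
  [/\ injective l,
      range l = \bigcup_n range (y n),
      forall n, continuous_inclusion (y n) l &
      forall (F : tvsType K) (f : {linear F -> V}),
        injective f -> range f = range l ->
        (forall n, continuous_inclusion (y n) f) ->
        continuous_inclusion l f].

(* Indices start at 0 instead of 1. *)
Record ind_spectrum (K : numFieldType) := IndSpectrum {
  ambient : lmodType K;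
  step : nat -> nat -> normedModType K;
  step_emb : forall N n, {linear step N n -> ambient};
  step_emb_inj : forall N n, injective (step_emb N n);
  step_incl : forall N n,
    continuous_inclusion (step_emb N n) (step_emb N n.+1);
  indlim : nat -> tvsType K;
  indlim_emb : forall N, {linear indlim N -> ambient};
  indlimP : forall N, is_inductive_limit (step_emb N) (indlim_emb N);
  indlim_incl : forall N,
    continuous_inclusion (indlim_emb N.+1) (indlim_emb N)
}.

Section Spectrum.
Variables (K : numFieldType) (S : ind_spectrum K).

Definition unit_ball (N n : nat) : set (ambient S) :=
  step_emb S N n @` [set x | `|x| <= 1].

Definition regular : Prop :=
  forall (N : nat) (B : set (indlim S N)), tvs_bounded B ->
    exists n (C : set (step S N n)),
      tvs_bounded C /\ step_emb S N n @` C = indlim_emb S N @` B.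

Definition normalized : Prop :=
  forall (N : nat) (B : set (indlim S N)), tvs_bounded B ->
    exists n, indlim_emb S N @` B `<=` unit_ball N n.

(* The topology of X is the initial one for the inclusions p N of X into the  *)
(* N-th inductive limits.                                                     *)
Definition is_projective_limit (X : tvsType K)
    (i : {linear X -> ambient S}) : Prop :=
  [/\ injective i,
      range i = \bigcap_N range (indlim_emb S N) &
      exists2 p : forall N, X -> indlim S N,
        (forall N x, indlim_emb S N (p N x) = i x) &
        forall U : set X, open U <->
          @open (sup_topology
            (fun N => Topological.on (initial_topology (p N)))) U].

End Spectrum.

Arguments unit_ball {K} S N n.

(* Main.v *)
From HB Require Import structures.
Require Import Defs.
From mathcomp Require Import all_boot all_order all_algebra complex.
From mathcomp Require Import all_classical all_reals all_analysis ring.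

(** If X is bornological, an absolutely convex bornivorous set T is a
0-neighbourhood of X. The X_N decrease with N, so T contains the trace on X of
a 0-neighbourhood of a single X_N ([projective_limit_nbhs0P]), and every
0-neighbourhood of X_N absorbs each ball B_{N,n} because the inclusion of
X_{N,n} is continuous; this is (B2).

Conversely, let T be absolutely convex and let N be given by (B2). The idea is
to enlarge T to an absolutely convex subset of X_N that knows about elements
outside X: let W be the union over n of the closures of (1/2)T in X_{N,n}.
These closures increase with n, so W is absolutely convex
([absconv_half_step_closure]). Two facts remain.
- The trace of W on X lies in T ([half_step_closure_trace]). If x in X is
  close to t/2 in X_{N,n}, then the error x - t/2 is a small multiple of an
  element of the ball B_{N,n} and lies in X, so by (B2) it belongs to (1/2)T.
- If M is given by (B1) for N, then W absorbs every ball B_{M,m}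
  ([half_step_closure_absorbs]). Indeed (B1) puts B_{M,m} inside the closure
  in some X_{N,n} of the trace of B_{N,n} on X, and (B2) puts that trace inside
  a multiple of T.
An absolutely convex set that absorbs the unit balls of the steps is a
0-neighbourhood of the inductive limit ([inductive_limit_nbhs0]); hence the
trace of W on X_M is one in X_M, and T is a 0-neighbourhood of X.

The inductive limit topology is known only through its universal property, so
the last principle needs a competing locally convex topology on the same space:
the one whose 0-neighbourhoods are the supersets of the positive multiples of W
(the topology of the gauge of W, here [disc_space]). The steps are continuously
included for it, because W absorbs their unit balls, so the inductive limit
topology is finer, and W is a 0-neighbourhood of the competitor. *)

Import Order.TTheory GRing.Theory Num.Theory.
Import numFieldNormedType.Exports.
Local Open Scope classical_set_scope.
Local Open Scope ring_scope.

Set Implicit Arguments.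
Unset Strict Implicit.
Unset Printing Implicit Defensive.

(** * Absolutely convex sets *)

(** Absolute convexity as one inequality on two coefficients: it makes sense in
a vector space without topology, and passes to preimages by linear maps and to
directed unions at once. *)
Definition absconv (K : numFieldType) (E : lmodType K) (W : set E) :=
  forall (a b : K) (x y : E), `|a| + `|b| <= 1 -> W x -> W y ->
    W (a *: x + b *: y).

Lemma absolutely_convexP (K : numFieldType) (E : tvsType K) (T : set E) :
  absolutely_convex T -> absconv T.
Proof.
move=> [Tcvx Tbal] a b x y ab Tx Ty.
pose s := `|a| + `|b|.
have [s0|s0] := eqVneq s 0.
  move: (s0) => /eqP; rewrite paddr_eq0// !normr_eq0 => /andP[/eqP -> /eqP ->].
  rewrite scale0r add0r scale0r -(scale0r x).
  by apply: Tbal => //; rewrite normr0.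
have sgt0 : 0 < s by rewrite lt_def s0 addr_ge0.
(* Both coefficients are replaced by their moduli, the phases being absorbed
   in the points; division by the total weight s gives a convex combination. *)
have Tsg (c : K) z : T z -> T ((c / `|c|) *: z).
  apply: Tbal; have [->|c0] := eqVneq c 0; first by rewrite mul0r normr0.
  by rewrite normrM normfV normr_id divff ?normr_eq0.
have csg (c : K) : c = s * (`|c| / s * (c / `|c|)).
  have [->|c0] := eqVneq c 0; first by rewrite normr0 !(mul0r, mulr0).
  by field; rewrite normr_eq0 c0.
have t01 : (0 <= `|a| / s <= 1).
  by rewrite divr_ge0//= ?(ltW sgt0)// ler_pdivrMr// mul1r lerDl.
have onemt : 1 - `|a| / s = `|b| / s.
  by rewrite -[1](divff s0) -mulrBl addrAC subrr add0r.
have /andP[t0 t1] := t01.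
have := Tcvx _ _ (Itv01 t0 t1) (mem_set (Tsg a _ Tx)) (mem_set (Tsg b _ Ty)).
move/set_mem; rewrite /conv/= /unstable.onem onemt => Tz.
have -> : a *: x + b *: y = s *: ((`|a| / s) *: ((a / `|a|) *: x) +
                                  (`|b| / s) *: ((b / `|b|) *: y)).
  by rewrite scalerDr !scalerA -(mulrA s) -(mulrA s) -!csg.
by apply: Tbal => //; rewrite ger0_norm// ltW.
Qed.

Lemma absconvZ (K : numFieldType) (E : lmodType K) (W : set E) (a : K) x :
  absconv W -> `|a| <= 1 -> W x -> W (a *: x).
Proof.
move=> cW a1 Wx; rewrite -[a *: x]addr0 -(scale0r x).
by apply: cW => //; rewrite normr0 addr0.
Qed.

(** * The locally convex topology defined by a disc *)

Record disc (K : numFieldType) (E : lmodType K) := Disc {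
  disc_set :> set E;
  disc_absconv : absconv disc_set;
  disc_absorbing : forall x, exists2 q : K, 0 < q & disc_set (q *: x)
}.

Lemma disc0 (K : numFieldType) (E : lmodType K) (W : disc E) : disc_set W 0.
Proof.
have [q _ Wq] := disc_absorbing W 0.
by rewrite -(scaler0 _ q).
Qed.

Lemma discZ (K : numFieldType) (E : lmodType K) (W : disc E) (a b : K) x :
  `|a| <= `|b| -> disc_set W (b *: x) -> disc_set W (a *: x).
Proof.
move=> ab Wbx; have [b0|b0] := eqVneq b 0.
  move: ab; rewrite b0 normr0 normr_le0 => /eqP ->.
  by rewrite scale0r; exact: disc0.
rewrite -(divfK b0 a) -scalerA; apply: absconvZ Wbx; first exact: disc_absconv.
by rewrite normrM normfV ler_pdivrMr ?normr_gt0// mul1r.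
Qed.

(** In terms of the gauge of [W], this is the triangle inequality for two
vectors of gauge at most 1/(2r). *)
Lemma disc_half (K : numFieldType) (E : lmodType K) (W : disc E) (r : K) x y :
  disc_set W ((2 * r) *: x) -> disc_set W ((2 * r) *: y) ->
  disc_set W (r *: (x + y)).
Proof.
move=> Wx Wy; rewrite scalerDr.
have h : forall z, r *: z = 2^-1 *: ((2 * r) *: z) :> E.
  by move=> z; rewrite scalerA mulrA mulVf ?pnatr_eq0// mul1r.
rewrite !h; apply: disc_absconv => //.
by rewrite ger0_norm ?invr_ge0 ?ler0n// [leLHS](_ : _ = 1)//; field.
Qed.

Lemma scale_conv_shift (K : numFieldType) (E : lmodType K) (r l : K)
    (x y v w : E) :
  r *: (l *: x + (1 - l) *: y + v - w) =
  l *: (r *: (x + v - w)) + (1 - l) *: (r *: (y + v - w)).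
Proof.
rewrite !scalerA ![_ * r]mulrC -!scalerA -scalerDr; congr (_ *: _).
rewrite -!addrA; move: (v - w) => u; rewrite [LHS]addrA.
by rewrite !scalerDr addrACA -scalerDl subrKC scale1r.
Qed.

(** A copy of the vector space [E], to carry the topology of the gauge of [W]
when [E] already has a topology. *)
Definition disc_space (K : numFieldType) (E : lmodType K) (W : disc E) : Type :=
  E.

Section DiscSpace.
Variables (K : numFieldType) (E : lmodType K) (W : disc E).
Local Notation D := (disc_space W).

HB.instance Definition _ := GRing.Lmodule.copy D E.

(** The radius of a ball is given by its inverse [r], so that the zero
multiple causes no exception and two balls intersect in that of parameter
[r1 + r2]: no minimum of scalars is needed in a partially ordered field. *)
Definition disc_nbhs (x : D) : set_system D :=
  [set A | exists2 r : K, 0 < r & forall v : D, disc_set W (r *: v) -> A (x + v)].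

HB.instance Definition _ := hasNbhs.Build D disc_nbhs.

Let disc_nbhs_filter (x : D) : ProperFilter (nbhs x).
Proof.
apply: Build_ProperFilter_ex.
  move=> A [r r0 rA]; exists (x + 0); apply: rA; rewrite scaler0; exact: disc0.
split.
- by exists 1.
- move=> A B [r r0 rA] [s s0 sB]; exists (r + s); first exact: addr_gt0.
  move=> v Wv; split.
    apply: rA; apply: discZ Wv.
    by rewrite !gtr0_norm ?addr_gt0// lerDl ltW.
  apply: sB; apply: discZ Wv.
  by rewrite !gtr0_norm ?addr_gt0// lerDr ltW.
- move=> A B AB [r r0 rA]; exists r => // v /rA; exact: AB.
Qed.

Let disc_nbhs_singleton (x : D) (A : set D) : nbhs x A -> A x.
Proof.
by move=> [r r0 rA]; rewrite -(addr0 x); apply: rA; rewrite scaler0; exact: disc0.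
Qed.

Let disc_nbhs_nbhs (x : D) (A : set D) : nbhs x A -> nbhs x (nbhs^~ A).
Proof.
move=> [r r0 rA]; exists (2 * r); first by rewrite mulr_gt0.
move=> v Wv; exists (2 * r); first by rewrite mulr_gt0.
by move=> u Wu; rewrite -addrA; apply: rA; exact: disc_half.
Qed.

HB.instance Definition _ := Nbhs_isNbhsTopological.Build D
  disc_nbhs_filter disc_nbhs_singleton disc_nbhs_nbhs.

Let disc_add_continuous : continuous (fun x : D * D => x.1 + x.2).
Proof.
move=> [x y] A [r r0 rA].
exists ([set x + v | v in [set v | disc_set W ((2 * r) *: v)]],
        [set y + v | v in [set v | disc_set W ((2 * r) *: v)]]).
  by split; exists (2 * r); rewrite ?mulr_gt0// => v Wv; exists v.
move=> [_ _] [/= [u Wu <-] [v Wv <-]].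
by rewrite /= addrACA; apply: rA; exact: disc_half.
Qed.

Let disc_scale_continuous : continuous (fun z : K^o * D => z.1 *: z.2).
Proof.
move=> [a x] A [r r0 rA].
have [q q0 Wqx] := disc_absorbing W x.
(* With q x in W, the vector (b - a) x + b v is small when |b - a| <= q / (2r)
   and |b| <= |a| + 1; the value of d is below q / (2r) and below 1. *)
pose d := q / (2 * r + q).
have rq0 : 0 < 2 * r + q by rewrite addr_gt0// mulr_gt0.
have d0 : 0 < d by rewrite divr_gt0.
pose s := 2 * r * (`|a| + 1).
have a0 : 0 < `|a| + 1 by rewrite ltr_wpDl.
have s0 : 0 < s by rewrite !mulr_gt0.
exists ([set b | `|a - b| < d],
        [set x + v | v in [set v | disc_set W (s *: v)]]).
  split; first by exists d.
  by exists s => // v Wv; exists v.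
move=> [b _] [/= ab [v Wv <-]].
have -> : b *: (x + v) = a *: x + ((b - a) *: x + b *: v).
  by rewrite addrA -scalerDl subrKC -scalerDr.
apply: rA.
have -> : r *: ((b - a) *: x + b *: v) =
    (r * (b - a) / q) *: (q *: x) + (r * b / s) *: (s *: v).
  by rewrite scalerDr !scalerA !divfK ?gt_eqF.
apply: disc_absconv => //.
rewrite !normrM !normfV (gtr0_norm r0) (gtr0_norm q0) (gtr0_norm s0) distrC.
rewrite [leRHS](_ : 1 = 2^-1 + 2^-1); last by field.
apply: lerD.
  rewrite ler_pdivrMr// -ler_pdivlMl// (le_trans (ltW ab))// /d.
  rewrite ler_pdivrMr// mulrDr -subr_ge0.
  rewrite (_ : _ - _ = q^+2 / (2 * r)); last by field; rewrite gt_eqF.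
  by rewrite divr_ge0 ?exprn_ge0// ?mulr_ge0// ltW.
rewrite ler_pdivrMr// /s.
rewrite (_ : _ * (_ * _) = r * (`|a| + 1)); last by field.
rewrite ler_pM2l// -[b](subrKC a) (le_trans (ler_normD _ _))// lerD2l distrC.
apply: le_trans (ltW ab) _.
by rewrite /d ler_pdivrMr// mul1r lerDr mulr_ge0// ltW.
Qed.

Let disc_locally_convex : exists2 B : set_system D,
  (forall b, b \in B -> convex_set b) & basis B.
Proof.
(* A ball x + W/r is a convex neighbourhood; its interior is also convex. *)
exists [set B : set D | open B /\ convex_set B].
  by move=> B /set_mem[].
split; first by move=> B [].
move=> x A [r r0 rA].
pose C := [set z : D | disc_set W (r *: (z - x))].
have nC : nbhs x C.
  by exists r => // v Wv; rewrite /C/= addrC addKr.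
exists C°; last first.
  move=> z /interior_subset Cz.
  by rewrite -(subrKC x z); exact: rA.
split=> //; split; first exact: open_interior.
move=> y1 y2 t /set_mem[r1 r10 C1] /set_mem[r2 r20 C2]; apply/mem_set.
exists (r1 + r2); first exact: addr_gt0.
move=> v Wv.
have Cv1 : C (y1 + v).
  by apply: C1; apply: discZ Wv; rewrite !gtr0_norm ?addr_gt0// lerDl ltW.
have Cv2 : C (y2 + v).
  by apply: C2; apply: discZ Wv; rewrite !gtr0_norm ?addr_gt0// lerDr ltW.
pose l := t%:num : K.
rewrite /C/= /conv/= /unstable.onem -/l.
have -> : r *: (l *: y1 + (1 - l) *: y2 + v - x) =
    l *: (r *: (y1 + v - x)) + (1 - l) *: (r *: (y2 + v - x)) :> D.
  exact: scale_conv_shift.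
apply: disc_absconv => //.
have l0 : 0 <= l by rewrite /l ge0.
have l1 : l <= 1 by rewrite /l le1.
by rewrite (ger0_norm l0) (@ger0_norm _ (1 - l)) ?subr_ge0// subrKC.
Qed.

(* This factory only builds the uniform structure; the algebraic continuity
   and local convexity become instances separately. *)
HB.instance Definition _ := PreTopologicalLmod_isTvs.Build K D
  disc_add_continuous disc_scale_continuous disc_locally_convex.
HB.instance Definition _ := PreTopologicalNmodule_isTopologicalNmodule.Build D
  disc_add_continuous.
HB.instance Definition _ := TopologicalNmodule_isTopologicalLmodule.Build K D
  disc_scale_continuous.
HB.instance Definition _ := Uniform_isTvs.Build K D disc_locally_convex.

End DiscSpace.

Lemma nbhs_disc_space (K : numFieldType) (E : lmodType K) (W : disc E) :
  nbhs (0 : disc_space W) (disc_set W).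
Proof. by exists 1 => // v; rewrite scale1r add0r. Qed.

(** * Neighbourhoods of zero in inductive and projective limits *)

(** The space [L] with the topology of the gauge of [W] competes with the
inductive limit topology, and [W] is one of its 0-neighbourhoods. Absorption
of the unit balls makes the steps continuously included in the competitor; as
they cover [L], it also makes [W] absorbing. *)
Lemma inductive_limit_nbhs0 (K : numFieldType) (V : lmodType K)
    (Y : nat -> normedModType K) (y : forall n, {linear Y n -> V})
    (L : tvsType K) (l : {linear L -> V}) (W : set L) :
  is_inductive_limit y l -> absconv W ->
  (forall n, exists2 q : K, 0 < q &
     forall u : Y n, `|u| <= 1 -> forall z : L, l z = y n u -> W (q *: z)) ->
  nbhs 0 W.
Proof.
move=> [l_inj rangel y_cont l_finest] Wcvx Wabs.
have absW x : exists2 q : K, 0 < q & W (q *: x).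
  have [n _ [u _ yu]] : (\bigcup_n range (y n)) (l x).
    by rewrite -rangel; exists x.
  have [q q0 Wq] := Wabs n.
  have c0 : 0 < `|u| + 1 by rewrite ltr_wpDl.
  exists (q / (`|u| + 1)); first by rewrite divr_gt0.
  rewrite -scalerA; apply: (Wq ((`|u| + 1)^-1 *: u)); last first.
    by rewrite !linearZ/= yu.
  by rewrite normrZ normfV (gtr0_norm c0) ler_pdivrMl// mulr1 lerDl.
pose D := Disc Wcvx absW.
pose f : {linear disc_space D -> V} := l.
have f_cont n : continuous_inclusion (y n) f.
  have [j lj _] := y_cont n; exists j => // u A [r r0 rA].
  have [q q0 Wq] := Wabs n.
  apply/nbhs_normP; exists (q / r); first by rewrite /= divr_gt0.
  move=> v /= uv.
  have -> : j v = (j u : disc_space D) + (j v - j u) by rewrite subrKC.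
  apply: rA.
  have -> : r *: ((j v : disc_space D) - j u) =
    q *: ((r / q) *: ((j v : disc_space D) - j u)).
    by rewrite scalerA mulrCA divff ?gt_eqF// mulr1.
  apply: (Wq ((r / q) *: (v - u))); last first.
    by rewrite !linearZ/= !linearB/= !lj.
  rewrite normrZ normrM normfV !gtr0_norm// -ler_pdivlMl ?divr_gt0//.
  by rewrite invf_div mulr1 distrC ltW.
have [j lj j_cont] := l_finest (disc_space D) f l_inj erefl f_cont.
have jE : j = id by apply/funext => x; apply: l_inj; exact: lj.
have := j_cont 0 W; rewrite jE; apply.
exact: (nbhs_disc_space D).
Qed.

Lemma continuous_inclusion_nbhs0 (K : numFieldType) (V : lmodType K)
    (F G : tvsType K)
    (f : {linear F -> V}) (g : {linear G -> V}) (U : set G) :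
  injective g -> continuous_inclusion f g -> nbhs 0 U ->
  nbhs 0 [set x | forall z, g z = f x -> U z].
Proof.
move=> g_inj [j gj j_cont] U0.
have j0 : j 0 = 0 by apply: g_inj; rewrite gj !linear0.
have := j_cont 0 U; rewrite j0 => /(_ U0).
apply: (@filterS _ _ _ (j @^-1` U)) => x Ux z gz.
by have -> : z = j x by apply: g_inj; rewrite gj.
Qed.

Lemma continuous_inclusion_ball (K : numFieldType) (V : lmodType K)
    (Y : normedModType K) (G : tvsType K)
    (y : {linear Y -> V}) (g : {linear G -> V}) (U : set G) :
  injective g -> continuous_inclusion y g -> nbhs 0 U ->
  exists2 r : K, 0 < r & forall u, `|u| <= r -> forall z, g z = y u -> U z.
Proof.
move=> g_inj yg /(continuous_inclusion_nbhs0 g_inj yg).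
move=> /nbhs_normP[r /= r0 rU].
exists (r / 2) => [|u ur]; first by rewrite divr_gt0.
apply: rU; rewrite /= sub0r normrN (le_lt_trans ur)//.
by rewrite ltr_pdivrMr// ltr_pMr// ltr1n.
Qed.

Lemma indlim_emb_inj (K : numFieldType) (S : ind_spectrum K) N :
  injective (indlim_emb S N).
Proof. by have [] := indlimP S N. Qed.

Lemma indlim_linking_nbhs0 (K : numFieldType) (S : ind_spectrum K) N M
    (U : set (indlim S N)) : (N <= M)%N -> nbhs 0 U ->
  nbhs 0 [set x | forall z, indlim_emb S N z = indlim_emb S M x -> U z].
Proof.
move=> NM U0; rewrite -(subnKC NM).
elim: (M - N)%N => [|d IHd].
  rewrite addn0; apply: filterS U0 => x Ux z /indlim_emb_inj ->; exact: Ux.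
rewrite addnS.
have := continuous_inclusion_nbhs0 (@indlim_emb_inj _ S _)
  (indlim_incl S (N + d)%N) IHd.
have [j ej _] := indlim_incl S (N + d)%N.
by apply: filterS => x /= Hx z zx; apply: (Hx (j x)); rewrite ej.
Qed.

(** The initial topology is generated by finite intersections of preimages; as
the spectrum is decreasing, one index suffices for all members of such an
intersection. *)
Lemma projective_limit_nbhs0P (K : numFieldType) (S : ind_spectrum K)
    (X : tvsType K) (i : {linear X -> ambient S}) (U : set X) :
  is_projective_limit i ->
  nbhs 0 U <-> exists N, exists2 W : set (indlim S N), nbhs 0 W &
    forall x z, indlim_emb S N z = i x -> W z -> U x.
Proof.
move=> [i_inj rangei [p ip openX]].
have p0 N : p N 0 = 0 by apply: (@indlim_emb_inj _ S N); rewrite ip !linear0.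
split=> [|[N [W W0 WU]]].
  rewrite nbhsE => -[Q [/openX Qop Q0] QU].
  (* The preimages of the 0-neighbourhoods of the [indlim S N] form a filter,
     and this filter converges to 0 for each of the initial topologies. *)
  pose F : set_system X := [set A | exists N,
    exists2 W : set (indlim S N), nbhs 0 W & forall x, W (p N x) -> A x].
  have FF : Filter F.
    split.
    - by exists 0, setT => //; exact: filterT.
    - move=> A B [N [W W0 WA]] [M [W' W'0 WB]].
      exists (maxn N M).
      pose trace P (V : set (indlim S P)) := [set x |
        forall z, indlim_emb S P z = indlim_emb S (maxn N M) x -> V z].
      exists (trace N W `&` trace M W').
        apply: filterI; apply: indlim_linking_nbhs0 => //.
          exact: leq_maxl.
        exact: leq_maxr.
      move=> x [h1 h2].
      by split; [apply/WA/h1|apply/WB/h2]; rewrite !ip.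
    - by move=> A B AB [N [W W0 WA]]; exists N, W => // x /WA; exact: AB.
  have F0 : F --> (0 : sup_topology
      (fun N => Topological.on (initial_topology (p N)))).
    apply/cvg_sup => N A [_ [[C Cop <-] /= C0] CA].
    exists N, C; last by move=> x Cx; exact: CA.
    by apply: open_nbhs_nbhs; split => //; rewrite -(p0 N).
  have [N [W W0 WQ]] : F Q by apply: F0; exact: open_nbhs_nbhs.
  exists N, W => // x z zx Wz; apply/QU/WQ.
  by have -> : p N x = z by apply: (@indlim_emb_inj _ S N); rewrite ip.
move: W0; rewrite nbhsE => -[C [Cop C0] CW].
apply: (@filterS _ _ _ (p N @^-1` C)).
  by move=> x Cx; apply: (WU _ (p N x)); rewrite ?ip//; exact: CW.
apply: open_nbhs_nbhs; split; last by rewrite /= p0.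
apply/openX.
pose T := sup_topology (fun N => Topological.on (initial_topology (p N))).
have : continuous (id : T -> initial_topology (p N)).
  move=> x; have /cvg_sup := @cvg_id _ (nbhs (x : T)).
  exact.
move/continuousP => /(_ (p N @^-1` C)); apply.
by exists C.
Qed.

(** * The closure of T/2 in the steps *)

(** The order of [R[i]] compares only numbers with equal imaginary parts, so a
positive element is a real number; hence the complex case reduces to the real
one. *)
Lemma archi_real_or_complex (K : numFieldType) : real_or_complex K ->
  forall x : K, 0 < x -> exists2 k : nat, (0 < k)%N & x <= k%:R.
Proof.
move=> [R [->|->]] x x0.
  exists (Num.truncn x).+1 => //.
  by rewrite ltW// truncnS_gt.
exists (Num.truncn (complex.Re x)).+1 => //.
case: x x0 => a b; rewrite ltcE/= => /andP[/eqP -> a0].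
have -> : ((Num.truncn a).+1%:R : R[i]) = ((Num.truncn a).+1%:R)%:C%C.
  by rewrite rmorph_nat.
by rewrite lecE/= eqxx ltW// truncnS_gt.
Qed.

Section StepClosure.
Variables (K : numFieldType) (S : ind_spectrum K) (X : tvsType K).
Variable i : {linear X -> ambient S}.
Implicit Types (N n : nat) (T : set X).

(** The closure of (1/2)T for the distance of the step X_{N,n}: T itself need
not lie in X_{N,n}, only the errors of approximation do. The factor 1/2 leaves
room for such an error in [half_step_closure_trace]. *)
Definition half_step_closure N n T : set (ambient S) :=
  [set v | forall e : K, 0 < e -> exists2 t, T t &
     exists2 u, `|u| <= e & v = i (2^-1 *: t) + step_emb S N n u].

(** The inclusions of the steps are continuous, so approximation in one step is
approximation in every later one. *)
Lemma half_step_closureS N n m T : (n <= m)%N ->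
  half_step_closure N n T `<=` half_step_closure N m T.
Proof.
move=> nm; rewrite -(subnKC nm); elim: (m - n)%N => [|d IHd].
  by rewrite addn0.
rewrite addnS => v /IHd vT e e0.
have ballB : nbhs (0 : step S N (n + d).+1) [set u | `|u| <= e].
  apply/nbhs_normP; exists e => // u /=.
  by rewrite sub0r normrN => /ltW.
have [r r0 rP] := continuous_inclusion_ball (@step_emb_inj _ S N _)
  (step_incl S N (n + d)) ballB.
have [j yj _] := step_incl S N (n + d).
have [t Tt [u ur vE]] := vT r r0; exists t => //; exists (j u).
  by apply: (rP u); rewrite // yj.
by rewrite yj.
Qed.

(** Two elements of the union lie in the closure for a common step, where
approximations can be combined. *)
Lemma absconv_half_step_closure N T : absconv T ->
  absconv (\bigcup_n half_step_closure N n T).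
Proof.
move=> Tcvx a b v w ab [n _ vn] [m _ wm].
exists (maxn n m) => // e e0.
have [t Tt [u ue ->]] := half_step_closureS (leq_maxl n m) vn e0.
have [t' Tt' [u' ue' ->]] := half_step_closureS (leq_maxr n m) wm e0.
exists (a *: t + b *: t'); first exact: Tcvx.
exists (a *: u + b *: u').
  rewrite (le_trans (ler_normD _ _))// !normrZ.
  rewrite (@le_trans _ _ (`|a| * e + `|b| * e))//.
    by apply: lerD; rewrite ler_wpM2l.
  by rewrite -mulrDl ler_piMl// ltW.
by rewrite !scalerDr !(linearD, linearZ)/= addrACA !scalerA.
Qed.

(** The error x - t/2 lies in X and in a ball of X_{N,n} so small that (B2) puts
it in (1/2)T; hence x is a half sum of two elements of T. *)
Lemma half_step_closure_trace N T : injective i -> absconv T ->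
  (forall n, exists2 s : K, 0 < s &
      unit_ball S N n `&` range i `<=` i @` [set s *: x | x in T]) ->
  forall x, (\bigcup_n half_step_closure N n T) (i x) -> T x.
Proof.
move=> i_inj Tcvx B2 x [n _ xn].
have [s s0 sT] := B2 n.
have s20 : 0 < 2 * s by rewrite mulr_gt0.
have [t Tt [u us xE]] : exists2 t, T t & exists2 u, `|u| <= (2 * s)^-1 &
    i x = i (2^-1 *: t) + step_emb S N n u.
  by apply: xn; rewrite invr_gt0.
have uE : step_emb S N n u = i (x - 2^-1 *: t).
  by rewrite linearB/= xE addrC addKr.
have [_ [t' Tt' <-] /i_inj] : (i @` [set s *: x | x in T])
    (i ((2 * s) *: (x - 2^-1 *: t))).
  apply: sT; split; last by exists ((2 * s) *: (x - 2^-1 *: t)).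
  exists ((2 * s) *: u); last by rewrite linearZ/= uE -linearZ.
  by rewrite /= normrZ gtr0_norm// -ler_pdivlMl// mulr1.
move=> st'.
have xt : x - 2^-1 *: t = 2^-1 *: t'.
  apply: (@scalerI _ _ (2 * s)); first by rewrite gt_eqF.
  by rewrite -st' scalerA mulrAC divff ?pnatr_eq0// mul1r.
rewrite -(subrKC (2^-1 *: t) x) xt.
apply: Tcvx => //.
by rewrite ger0_norm ?invr_ge0 ?ler0n// [leLHS](_ : _ = 1)//; field.
Qed.

(** An element of the ball B_{M,m} is by (B1) a limit in X_{N,n} of elements of
the trace of B_{N,n} on X, which by (B2) belong to sT; dividing by 2s gives a
limit of elements of (1/2)T. *)
Lemma half_step_closure_absorbs N n T (s : K) (v : ambient S) :
  real_or_complex K -> 0 < s ->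
  unit_ball S N n `&` range i `<=` i @` [set s *: x | x in T] ->
  (\bigcap_(k in [set k : nat | (0 < k)%N])
     [set a + b | a in unit_ball S N n `&` range i
                & b in [set k%:R^-1 *: c | c in unit_ball S N n]]) v ->
  half_step_closure N n T ((2 * s)^-1 *: v).
Proof.
move=> hK s0 sT vcap e e0.
have s20 : 0 < 2 * s by rewrite mulr_gt0.
have [k k0 ek] : exists2 k : nat, (0 < k)%N & (2 * s * e)^-1 <= k%:R.
  by apply: archi_real_or_complex; rewrite // invr_gt0 mulr_gt0.
have [a /sT[_ [t Tt <-] <-] [_ [_ [u u1 <-] <-] <-]] := vcap k k0.
exists t => //; exists ((2 * s)^-1 *: (k%:R^-1 *: u)).
  rewrite scalerA normrZ gtr0_norm ?mulr_gt0 ?invr_gt0 ?ltr0n//.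
  rewrite (@le_trans _ _ ((2 * s)^-1 * k%:R^-1))//.
    by rewrite ler_piMr// ltW// mulr_gt0 ?invr_gt0 ?ltr0n.
  by rewrite ler_pdivrMr ?ltr0n// -ler_pdivrMl// mulrC -invfM.
have h : s / (2 * s) = 2^-1 by field; rewrite gt_eqF.
by rewrite scalerDr !linearZ/= !scalerA h [X in _ + X *: _]mulrC.
Qed.

End StepClosure.

(** * The criterion *)

Theorem theorem2p1 (K : numFieldType) (hK : real_or_complex K)
    (S : ind_spectrum K) (hreg : regular S) (hnorm : normalized S)
    (X : tvsType K) (i : {linear X -> ambient S})
    (hX : is_projective_limit i)
    (B1 : forall N, exists M, forall m, exists n,
      unit_ball S M m `<=`
        \bigcap_(k in [set k : nat | (0 < k)%N])
          [set a + b | a in unit_ball S N n `&` range i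
                     & b in [set k%:R^-1 *: c | c in unit_ball S N n]]) :
  bornological X <->
  (forall T : set X, absolutely_convex T -> bornivorous T ->
    exists N, forall n, exists2 s : K, 0 < s &
      unit_ball S N n `&` range i `<=` i @` [set s *: x | x in T]).
Proof.
have [i_inj _ [p ip _]] := hX.
split=> [bornX T Tcvx Tborn|B2 T Tcvx Tborn].
  have /(projective_limit_nbhs0P _ hX)[N [W W0 WT]] := bornX T Tcvx Tborn.
  exists N => n.
  have [l_inj _ y_cont _] := indlimP S N.
  have [r r0 rW] := continuous_inclusion_ball l_inj (y_cont n) W0.
  exists r^-1; first by rewrite invr_gt0.
  move=> _ [[u /= u1 <-] [x _ xu]].
  exists x => //; exists (r *: x); last first.
    by rewrite scalerA mulVf ?gt_eqF// scale1r.
  apply: (WT _ (p N (r *: x))); first exact: ip.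
  apply: (rW (r *: u)); last by rewrite ip !linearZ/= xu.
  by rewrite normrZ gtr0_norm// ler_piMr// ltW.
have Tac := absolutely_convexP Tcvx.
have [N NB2] := B2 T Tcvx Tborn.
have [M MB1] := B1 N.
apply/(projective_limit_nbhs0P _ hX); exists M.
exists (indlim_emb S M @^-1` \bigcup_n half_step_closure i N n T); last first.
  move=> x z zx Wz; apply: (half_step_closure_trace i_inj Tac NB2).
  by rewrite -zx.
apply: (inductive_limit_nbhs0 (indlimP S M)).
  move=> a b z w ab Wz Ww; rewrite /= linearD/= !linearZ/=.
  exact: absconv_half_step_closure.
move=> m; have [n nB1] := MB1 m; have [s s0 sT] := NB2 n.
exists (2 * s)^-1; first by rewrite invr_gt0 mulr_gt0.
move=> u u1 z zu; rewrite /= linearZ/=; exists n => //.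
by apply: half_step_closure_absorbs => //; apply: nB1; exists u.
Qed.
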